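(* For every (real) Banach space $E$, the free Banach lattice $FBL[E]$ generated by $E$ satisfies the $\sigma$-bounded chain condition. That is, the set $FBL[E]^+$ of nonzero positive elements of $FBL[E]$ admits a countable decomposition $FBL[E]^+ = \bigcup_{n\ge 2} \mathcal{F}_n$ such that, for every $n\ge 2$, every subset $\mathcal{G}\subset \mathcal{F}_n$ with exactly $n$ elements contains two distinct elements $f,g\in\mathcal{G}$ with $f\wedge g\neq 0$.
   Context: Banach spaces and Banach lattices are real. For a Banach space $E$, let $B_E$ be its closed unit ball and $E^*$ its dual. A function $f:E^*\to\mathbb{R}$ is positively homogeneous if $f(rx^* )=rf(x^* )$ for all $x^*\in E^*$ and $r>0$. For a function $f:E^*\to\mathbb{R}$ define $$\|f\|_{FBL[E]} = \sup\left\{\sum_{i=1}^n |f(x_i^* )| : n\in\mathbb{N},\ x_1^*,\ldots,x_n^*\in E^*,\ \sup_{x\in B_E}\sum_{i=1}^n |x_i^*(x)|\le 1\right\}\in[0,\infty].$$ This is a norm on the vector space of positively homogeneous functions $f:E^*\to\mathbb{R}$ with $\|f\|_{FBL[E]}<\infty$. For $x\in E$ let $\delta_x:E^*\to\mathbb{R}$, $\delta_x(x^* )=x^*(x)$. The free Banach lattice $FBL[E]$ is the closure, with respect to $\|\cdot\|_{FBL[E]}$, in that normed space, of the vector sublattice of $\mathbb{R}^{E^*}$ (with pointwise order and pointwise lattice operations) generated by $\{\delta_x : x\in E\}$. The order $\le$ and the operations $\wedge,\vee$ on $FBL[E]$ are pointwise. (Equivalently, up to Banach lattice isometry, $FBL[E]$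 is the Banach lattice $F$ with a linear isometric embedding $\phi:E\to F$ such that every bounded operator $T:E\to X$ into a Banach lattice $X$ factors as $T=\hat T\circ\phi$ for a unique lattice homomorphism $\hat T:F\to X$ with $\|\hat T\|=\|T\|$.) For a lattice of functions or Banach lattice $X$, $X^+$ denotes the set of its nonzero positive elements, i.e. those $f\in X$ with $f\ge 0$ and $f\ne 0$. *)

(* Defs.v *)
From HB Require Import structures.
From mathcomp Require Import all_boot all_order all_algebra.
From mathcomp Require Import all_classical all_reals ereal topology normedtype.

Set Implicit Arguments.
Unset Strict Implicit.
Unset Printing Implicit Defensive.

Import Order.TTheory GRing.Theory Num.Theory.
Import numFieldNormedType.Exports.

Local Open Scope classical_set_scope.
Local Open Scope ring_scope.

Section Dual.
Context {R : realType} (E : normedModType R).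

Definition continuous_functional : {pred E -> R^o} :=
  [pred phi : E -> R^o | `[< scalar phi /\ continuous phi >]].

Lemma continuous_functional_submod : submod_closed continuous_functional.
Proof.
split=> [|a f g].
  apply/asboolP; split=> [b u v|]; last exact: cst_continuous.
  by rewrite -[LHS]/(0 : R) -[RHS]/(b * 0 + 0) mulr0 addr0.
move=> /asboolP[flin fcont] /asboolP[glin gcont]; apply/asboolP; split.
  move=> b u v.
  rewrite -[LHS]/(a * f (b *: u + v) + g (b *: u + v)) flin glin.
  rewrite -[RHS]/(b * (a * f u + g u) + (a * f v + g v)).
  by rewrite !mulrDr addrACA mulrCA.
move=> x; apply: (@cvgD _ _ _ _ _ (fun y => a * f y)); last exact: gcont.
by apply: cvgMr; exact: fcont.
Qed.

HB.instance Definition _ := GRing.isSubmodClosed.Build R (E -> R^o)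
  continuous_functional
  (GRing.submod_closed_semi continuous_functional_submod).

(* The topological dual E^*, as a submodule of the R-module E -> R^o. *)
Record dual := Dual {
  dual_val :> E -> R^o;
  dualP : dual_val \in continuous_functional }.

HB.instance Definition _ := [isSub for dual_val].
HB.instance Definition _ := [Choice of dual by <:].
HB.instance Definition _ := [SubChoice_isSubLmodule of dual by <:].

End Dual.

Section FreeBanachLattice.
Context {R : realType} (E : normedModType R).
Implicit Types f g : dual E -> R.

Definition pos_homogeneous f :=
  forall (r : R) (phi : dual E), 0 < r -> f (r *: phi) = r * f phi.

Definition unit_ball : set E := [set x | `|x| <= 1].

Definition weak_l1_norm n (phi : 'I_n -> dual E) : \bar R :=
  ereal_sup [set (\sum_(i < n) `|phi i x|)%:E | x in unit_ball].

Definition fbl_norm f : \bar R :=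
  ereal_sup [set s : \bar R | exists (n : nat) (phi : 'I_n -> dual E),
    (weak_l1_norm phi <= 1)%E /\ s = (\sum_(i < n) `|f (phi i)|)%:E].

Definition eval_at (x : E) : dual E -> R := fun phi => phi x.

Definition vector_sublattice (L : set (dual E -> R)) :=
  [/\ L (fun=> 0),
      forall (a b : R) f g, L f -> L g -> L (fun phi => a * f phi + b * g phi),
      forall f g, L f -> L g -> L (f \min g) &
      forall f g, L f -> L g -> L (f \max g)].

Definition free_vector_lattice : set (dual E -> R) :=
  smallest vector_sublattice (range eval_at).

(* FBL[E]: the closure is taken in the normed space of positively homogeneous
   functions with finite norm, its members being actual functions on E^*. *)
Definition FBL : set (dual E -> R) :=
  [set f | [/\ pos_homogeneous f, (fbl_norm f < +oo)%E &
    forall e : R, 0 < e ->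
      exists2 g, free_vector_lattice g &
        (fbl_norm (fun phi => f phi - g phi)%R < e%:E)%E]].

End FreeBanachLattice.

Arguments free_vector_lattice {R} E _.
Arguments FBL {R} E _.

Definition nonzero_positive {R : realType} {T : Type} (X : set (T -> R)) :
    set (T -> R) :=
  [set f | [/\ X f, forall t, 0 <= f t & f <> (fun=> 0)]].

(* Main.v *)
(* A member f of FBL[E] is weak*-continuous on bounded sets: in the FBL norm,
   hence uniformly on bounded sets, it is a limit of lattice combinations of
   evaluations. So if f(phi) > 0 with phi in the unit ball of E^*, there are
   finitely many x_1, ..., x_m in E such that f(psi) > 0 whenever ||psi|| <= 3
   and |psi(x_l) - phi(x_l)| < 1 for all l. Sort the f by a bound for m and for
   all ||x_l||. Given many f_i in one class, with witnesses phi_i and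
   (x^i_l)_l, colour the ordered pair (i, k) by the integer parts of the
   phi_i(x^k_l), of which there are finitely many. A Ramsey argument gives
   i, j, k such that (j, i), (k, i) have the same colour, and so have (i, k),
   (j, k). Then phi_i - phi_j + phi_k has norm at most 3, is close to phi_i on
   the x^i_l and to phi_k on the x^k_l, so that f_i and f_k are both positive
   there. *)
Require Import Defs.
From HB Require Import structures.
From mathcomp Require Import all_boot all_order all_algebra.
From mathcomp Require Import all_classical all_reals ereal topology normedtype.
From mathcomp Require Import lra.

Import Order.TTheory GRing.Theory Num.Theory.
Import numFieldNormedType.Exports.

Local Open Scope classical_set_scope.
Local Open Scope ring_scope.

(** * Ramsey argument for colourings of ordered pairs *)

Fixpoint coloring_bound (K r : nat) : nat :=
  if r is r'.+1 then (K * coloring_bound K r').+2 else 1.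

(** Pick [i], pass to a large class of the colouring [j |-> c j i] of the other elements, and
    recurse inside it: everything chosen later, [k] included, has the same colour towards [i]. *)
Lemma end_homogeneous_seq {T C : finType} (c : T -> T -> C) (r : nat)
    (A : {set T}) :
  (coloring_bound #|C| r <= #|A|)%N ->
  exists s k, [/\ size s = r, uniq (rcons s k), {subset rcons s k <= A} &
    pairwise (fun i j => c j i == c k i) s].
Proof.
elim: r A => [|r IHr] A /= hA.
  have [k kA] : exists k, k \in A by apply/set0Pn; rewrite -card_gt0.
  by exists [::], k; split => //= x; rewrite inE => /eqP->.
have [i iA] : exists i, i \in A.
  by apply/set0Pn; rewrite -card_gt0; apply: leq_trans hA.
have [x hx] : exists x,
    (coloring_bound #|C| r <= #|[set j in A :\ i | c j i == x]|)%N.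
  apply/existsP; rewrite -[X in is_true X]negbK negb_exists.
  apply/negP => /forallP small.
  have : (#|A :\ i| <= \sum_(x : C) coloring_bound #|C| r)%N.
    rewrite -sum1_card (partition_big (c^~ i) xpredT) //=.
    apply: leq_sum => x _; rewrite sum1dep_card.
    by have := small x; rewrite -ltnNge => /ltnW.
  (* Of the two extra elements in [coloring_bound], one is [i] and the other makes this pigeonhole
     inequality strict. *)
  rewrite big_const iter_addn_0 mulnC leqNgt => /negP; apply.
  by move: hA; rewrite (cardsD1 i A) iA.
have [s [k [ss us sA ps]]] := IHr _ hx.
exists (i :: s), k; split => /=.
- by rewrite ss.
- by rewrite us andbT; apply/negP => /sA; rewrite !inE eqxx.
- move=> j; rewrite inE => /predU1P[->//|/sA].
  by rewrite !inE => /andP[/andP[]].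
- have ci j : j \in rcons s k -> c j i = x.
    by move=> /sA; rewrite !inE => /andP[_ /eqP].
  rewrite ps andbT; apply/allP => j js.
  by rewrite !ci ?mem_rcons ?inE ?eqxx ?js ?orbT.
Qed.

Lemma monochromatic_triple {T C : finType} (c : T -> T -> C) :
  (coloring_bound #|C| #|C|.+1 <= #|T|)%N ->
  exists i j k, [/\ i != k, c j i = c k i & c i k = c j k].
Proof.
rewrite -(cardsT T) => /(end_homogeneous_seq c)[s [k [ss us _ ps]]].
(* [s] has one element more than there are colours, so two of its elements have the same colour
   towards [k]. *)
have : ~~ uniq [seq c i k | i <- s].
  apply/negP => /card_uniqP; rewrite size_map ss => e.
  by have := max_card [in [seq c i k | i <- s]]; rewrite e ltnn.
case/(uniqPn (c k k)) => a [b []]; rewrite size_map => ab bs.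
have as_ := ltn_trans ab bs.
rewrite !(nth_map k) // => cab.
exists (nth k s a), (nth k s b), k; split => //.
- move: us; rewrite rcons_uniq => /andP[ks _].
  by apply: contraNneq ks => <-; rewrite mem_nth.
- by apply/eqP; move/(pairwiseP k): ps; apply; rewrite ?inE.
Qed.

(** Serves to number the classes: an index [n = h m] determines [m] and is at least the Ramsey bound
    for [m]. *)
Lemma injective_majorant (N : nat -> nat) :
  exists2 h : nat -> nat, injective h & forall m, (N m <= h m)%N.
Proof.
pose h m := (\sum_(i < m.+1) (N i).+1)%N.
have hS m : (h m < h m.+1)%N.
  by rewrite /h [ltnRHS]big_ord_recr /= addnS ltnS leq_addr.
exists h => [|m]; last by rewrite /h big_ord_recr /= addnS ltnW // ltnS leq_addl.
move=> a b hab.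
by case: (ltngtP a b) => // /(homo_ltn ltn_trans hS); rewrite hab ltnn.
Qed.

Lemma truncn_eq_dist_lt1 {R : realType} (a b : R) :
  0 <= a -> 0 <= b -> Num.truncn a = Num.truncn b -> `|a - b| < 1.
Proof.
move=> /truncn_itv /andP[la ua] /truncn_itv /andP[lb ub] e.
rewrite e in la ua; move: ua ub; rewrite -natr1 => ua ub.
by rewrite ltr_norml; apply/andP; split; lra.
Qed.

(** * Weak* continuity and positivity on cylinders of functionals *)

Section Dual.
Context {R : realType} {E : normedModType R}.
Implicit Types (phi psi : dual E) (f g : dual E -> R) (x : E) (s : seq E).

Lemma dual_addE phi psi x : (phi + psi) x = phi x + psi x.
Proof. by []. Qed.

Lemma dual_subE phi psi x : (phi - psi) x = phi x - psi x.
Proof. by []. Qed.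

Lemma dual_scaleE a phi x : (a *: phi) x = a * phi x.
Proof. by []. Qed.

Lemma dual_scalar phi : scalar phi.
Proof. by have /asboolP[] := dualP phi. Qed.

Lemma dual_linearZ phi a x : phi (a *: x) = a * phi x.
Proof.
have h0 : phi 0 = 0.
  by have := dual_scalar phi (-1) 0 0; rewrite scaler0 addr0 mulN1r addNr.
by have := dual_scalar phi a x 0; rewrite h0 !addr0.
Qed.

Definition dual_ball (r : R) : set (dual E) :=
  [set phi | forall x, `|phi x| <= r * `|x|].

Lemma dual_bounded phi : exists2 r, 0 < r & dual_ball r phi.
Proof.
have /asboolP[lin cont] := dualP phi.
pose L : {linear E -> R^o} := HB.pack (dual_val phi)
  (GRing.isLinear.Build R E R^o *:%R (dual_val phi) lin).
have /linear_boundedP [M [_ hM]] : bounded_near L (nbhs 0).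
  by apply: continuous_linear_bounded; exact: cont.
exists (`|M| + 1); first by rewrite ltr_wpDl.
by apply: hM; rewrite (le_lt_trans (ler_norm M)) // ltrDl.
Qed.

Lemma weak_l1_norm1_le1 phi :
  dual_ball 1 phi -> (weak_l1_norm (fun _ : 'I_1 => phi) <= 1)%E.
Proof.
move=> hphi; apply: ge_ereal_sup => _ [x xB <-].
by rewrite big_ord1 lee_fin (le_trans (hphi x)) // mul1r.
Qed.

Lemma abs_le_fbl_norm f phi :
  dual_ball 1 phi -> (`|f phi|%:E <= fbl_norm f)%E.
Proof.
move=> hphi; apply: ereal_sup_ubound; exists 1, (fun=> phi).
by split; [exact: weak_l1_norm1_le1|rewrite big_ord1].
Qed.

(** The fixed tolerance 1 loses no generality, since the points of [s] can be rescaled. *)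
Definition weak_star_continuous f := forall phi (e : R), 0 < e ->
  exists s, forall psi, (forall x, x \in s -> `|psi x - phi x| < 1) ->
    `|f psi - f phi| < e.

Lemma weak_star_continuous_pair f g phi (e : R) :
  weak_star_continuous f -> weak_star_continuous g -> 0 < e ->
  exists s, forall psi, (forall x, x \in s -> `|psi x - phi x| < 1) ->
    `|f psi - f phi| < e /\ `|g psi - g phi| < e.
Proof.
move=> cf cg e0; have [s hs] := cf phi _ e0; have [t ht] := cg phi _ e0.
exists (s ++ t) => psi hpsi; split.
  by apply: hs => x xs; apply: hpsi; rewrite mem_cat xs.
by apply: ht => x xt; apply: hpsi; rewrite mem_cat xt orbT.
Qed.

Lemma lattice_weak_star_continuous_homogeneous :
  vector_sublattice [set f | pos_homogeneous f /\ weak_star_continuous f].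
Proof.
split.
- split=> [r phi _|phi e e0]; first by rewrite mulr0.
  by exists [::] => psi _; rewrite subrr normr0.
- move=> a b f g [hf cf] [hg cg]; split=> [r phi r0|phi e e0].
    by rewrite hf // hg //; lra.
  have d0 : 0 < e / (`|a| + `|b| + 1) by rewrite divr_gt0 // ltr_wpDl // addr_ge0.
  have [s hs] := weak_star_continuous_pair f g phi _ cf cg d0.
  exists s => psi /hs[{}hs ht].
  set d := e / _ in d0 hs ht.
  have ed : e = d * (`|a| + `|b| + 1).
    by rewrite mulfVK // gt_eqF // ltr_wpDl // addr_ge0.
  have -> : a * f psi + b * g psi - (a * f phi + b * g phi)
    = a * (f psi - f phi) + b * (g psi - g phi) by lra.
  apply: le_lt_trans (ler_normD _ _) _; rewrite !normrM ed.
  have := ler_wpM2l (normr_ge0 a) (ltW hs).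
  have := ler_wpM2l (normr_ge0 b) (ltW ht).
  by lra.
- move=> f g [hf cf] [hg cg]; split=> [r phi r0|phi e e0].
    by rewrite /= hf // hg // minr_pMr // ltW.
  have [s hs] := weak_star_continuous_pair f g phi e cf cg e0.
  exists s => psi /hs[]; rewrite /= !ltr_norml => /andP[? ?] /andP[? ?].
  by case: (leP (f psi)); case: (leP (f phi)) => ? ?; apply/andP; split; lra.
- move=> f g [hf cf] [hg cg]; split=> [r phi r0|phi e e0].
    by rewrite /= hf // hg // maxr_pMr // ltW.
  have [s hs] := weak_star_continuous_pair f g phi e cf cg e0.
  exists s => psi /hs[]; rewrite /= !ltr_norml => /andP[? ?] /andP[? ?].
  by case: (leP (f psi)); case: (leP (f phi)) => ? ?; apply/andP; split; lra.
Qed.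

Lemma free_vector_lattice_weak_star_continuous_homogeneous f :
  free_vector_lattice E f -> pos_homogeneous f /\ weak_star_continuous f.
Proof.
apply: (smallest_sub lattice_weak_star_continuous_homogeneous).
move=> _ [x _ <-]; split=> [//|phi e e0].
(* Tolerance 1 at [e^-1 *: x] is tolerance [e] at [x]. *)
exists [:: e^-1 *: x] => psi /(_ _ (mem_head _ _)).
rewrite !dual_linearZ -mulrBr normrM gtr0_norm ?invr_gt0 //.
by rewrite mulrC ltr_pdivrMr // mul1r.
Qed.

(** A single [m] gives the number of points and bounds their norms, so that one integer indexes the
    classes. Radius 3 leaves room for a signed sum of three functionals from the unit ball. *)
Definition positive_cylinder (m : nat) f (x : 'I_m -> E) phi :=
  [/\ dual_ball 1 phi, forall l, `|x l| <= m%:R &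
    forall psi, dual_ball 3 psi -> (forall l, `|psi (x l) - phi (x l)| < 1) ->
      0 < f psi].

Lemma FBL_positive_cylinder f : nonzero_positive (FBL E) f ->
  exists m (x : 'I_m -> E) phi, positive_cylinder m f x phi.
Proof.
move=> [[hf _ apx] f0 fN0].
have [phi1 fphi1] : exists phi, 0 < f phi.
  apply: contrapT => /forallNP h; apply: fN0; apply/funext => phi.
  by apply/eqP; rewrite eq_le f0 andbT leNgt; apply/negP.
have [r r0 phi1r] := dual_bounded phi1.
pose phi := r^-1 *: phi1.
have phiB : dual_ball 1 phi.
  move=> x; rewrite dual_scaleE normrM gtr0_norm ?invr_gt0 // mulrC.
  by rewrite ler_pdivrMr // mul1r mulrC.
have fphi : 0 < f phi by rewrite hf ?invr_gt0 // mulr_gt0 ?invr_gt0.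
(* Going from [f phi] to [f psi] through [g] costs 3/8 of [f phi] at each end and 1/8 in between,
   7/8 in all. *)
have e0 : 0 < f phi / 8 by rewrite divr_gt0.
have [g /free_vector_lattice_weak_star_continuous_homogeneous [hg cg] fg] :=
  apx _ e0.
have fgB psi : dual_ball 3 psi -> `|f psi - g psi| < 3 * (f phi / 8).
  move=> psi3; have i3 : 0 < 3^-1 :> R by rewrite invr_gt0.
  have : dual_ball 1 (3^-1 *: psi).
    by move=> x; rewrite dual_scaleE normrM gtr0_norm //; have := psi3 x; lra.
  move/(abs_le_fbl_norm (fun phi => f phi - g phi))/le_lt_trans/(_ fg).
  by rewrite lte_fin hf // hg // -mulrBr normrM gtr0_norm //; lra.
have [s hs] := cg phi _ e0.
have [M hM] : exists M : nat, forall x, x \in s -> `|x| <= M%:R.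
  elim: s {hs} => [|x s [M hM]]; first by exists 0.
  exists (maxn M (Num.bound `|x|)) => y; rewrite inE => /predU1P[->|ys].
    apply: le_trans (ltW (archi_boundP (normr_ge0 x))) _.
    by rewrite ler_nat leq_maxr.
  by apply: le_trans (hM _ ys) _; rewrite ler_nat leq_maxl.
pose m := maxn M (size s).
(* Beyond the end of [s] the family is padded with the zero vector. *)
exists m, (fun l => s`_l), phi; split => // [l|psi psi3 hpsi].
  have [ls|ls] := ltnP l (size s); last by rewrite nth_default // normr0.
  by apply: le_trans (hM _ (mem_nth _ ls)) _; rewrite ler_nat leq_maxl.
have /hs : forall x, x \in s -> `|psi x - phi x| < 1.
  move=> x /(nthP 0)[l ls <-].
  by apply: (hpsi (Ordinal (leq_trans ls (leq_maxr M _)))).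
have phi3 : dual_ball 3 phi.
  by move=> x; apply: le_trans (phiB x) _; rewrite ler_wpM2r // ler1n.
have := fgB _ psi3; have := fgB _ phi3; rewrite !ltr_norml.
by move=> /andP[? ?] /andP[? ?] /andP[? ?]; lra.
Qed.

Lemma positive_cylinder_meet (m : nat) f g (x y : 'I_m -> E) phi chi psi :
  positive_cylinder m f x phi -> positive_cylinder m g y psi -> dual_ball 1 chi ->
  (forall l, `|psi (x l) - chi (x l)| < 1) ->
  (forall l, `|phi (y l) - chi (y l)| < 1) -> f \min g <> (fun=> 0).
Proof.
move=> [phiB _ hf] [psiB _ hg] chiB hx hy fg0.
(* [w - phi = psi - chi] is small on the [x l], and [w - psi = phi - chi] is small on the [y l]. *)
pose w := phi - chi + psi.
have w3 : dual_ball 3 w.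
  move=> z; rewrite dual_addE dual_subE.
  have := phiB z; have := psiB z; have := chiB z; rewrite !ler_norml.
  by move=> /andP[? ?] /andP[? ?] /andP[? ?]; apply/andP; split; lra.
have fw : 0 < f w.
  apply: hf => // l; rewrite dual_addE dual_subE.
  by have := hx l; congr (`|_| < _); lra.
have gw : 0 < g w.
  apply: hg => // l; rewrite dual_addE dual_subE.
  by have := hy l; congr (`|_| < _); lra.
have := congr1 (@^~ w) fg0 => /= e.
have : 0 < Num.min (f w) (g w) by rewrite lt_min fw gw.
by rewrite e ltxx.
Qed.

Lemma cylinder_coloring (m : nat) (T : finType) (x : T -> 'I_m -> E)
    (phi : T -> dual E) :
  (forall i l, `|x i l| <= m%:R) -> (forall i, dual_ball 1 (phi i)) ->
  exists c : T -> T -> {ffun 'I_m -> 'I_(m + m).+1}, forall i j k,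
    c i k = c j k -> forall l, `|phi i (x k l) - phi j (x k l)| < 1.
Proof.
move=> xm phiB.
(* The shift moves the values into the interval from 0 to [2m], where truncation is the integer part
   and takes at most [2m + 1] values. *)
pose v i k l := phi i (x k l) + m%:R.
have vm i k l : - m%:R <= phi i (x k l) <= m%:R.
  by rewrite -ler_norml (le_trans (phiB i _)) // mul1r.
have v0 i k l : 0 <= v i k l by have /andP[] := vm i k l; rewrite /v; lra.
have vlt i k l : (Num.truncn (v i k l) < (m + m).+1)%N.
  rewrite ltnS truncn_le_nat -natr1 natrD.
  by have /andP[] := vm i k l; rewrite /v; lra.
exists (fun i k => [ffun l => Ordinal (vlt i k l)]) => i j k /ffunP cE l.
have := cE l; rewrite !ffunE => -[] /(truncn_eq_dist_lt1 _ _ (v0 _ _ _) (v0 _ _ _)).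
by congr (`|_| < _); rewrite /v; lra.
Qed.

End Dual.

(** * Sorting the nonzero positive elements by the size of their cylinders *)

Theorem theorem1p2 (R : realType) (E : completeNormedModType R) :
  exists F : nat -> set (dual E -> R),
    nonzero_positive (FBL E) = \bigcup_(n >= 2) F n /\
    forall n : nat, (2 <= n)%N ->
      forall G : set (dual E -> R), G `<=` F n -> (G #= `I_n)%card ->
        exists f g : dual E -> R,
          [/\ G f, G g, f <> g & f \min g <> (fun=> 0)].
Proof.
pose K m := #|{ffun 'I_m -> 'I_(m + m).+1}|.
have [h hinj hle] := injective_majorant
  (fun m => maxn 2 (coloring_bound (K m) (K m).+1)).
pose P m f := exists (x : 'I_m -> E) phi, positive_cylinder m f x phi.
exists (fun n => [set f | nonzero_positive (FBL E) f /\
  exists2 m, h m = n & P m f]); split.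
  apply/seteqP; split=> [f fp|f [n _ []] //].
  have [m Pmf] := FBL_positive_cylinder f fp.
  exists (h m); first by apply: leq_trans (hle m); rewrite leq_maxl.
  by split => //; exists m.
move=> n n2 G GF; rewrite card_eq_sym => /card_set_bijP[u [uG uinj _]].
(* [G] is nonempty, so some member supplies [m]; injectivity of [h] then makes this [m] valid for
   all members. *)
have [m hm] : exists m, h m = n.
  by have [_ [m hm _]] := GF _ (uG 0 (ltnW n2)); exists m.
have Pu (i : 'I_n) : P m (u i).
  have [_ [m' hm']] := GF _ (uG i (ltn_ord i)).
  by rewrite -hm in hm'; rewrite (hinj _ _ hm').
have [x hx] := choice Pu; have [phi cyl] := choice hx.
have [c hc] : exists c : 'I_n -> 'I_n -> {ffun 'I_m -> 'I_(m + m).+1},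
    forall i j k, c i k = c j k ->
    forall l, `|phi i (x k l) - phi j (x k l)| < 1.
  by apply: cylinder_coloring => i; case: (cyl i).
have [] := monochromatic_triple c.
  by rewrite card_ord -hm; apply: leq_trans (hle m); rewrite leq_maxr.
move=> i [j [k [ik cji cik]]].
exists (u i), (u k); split; [exact: uG (ltn_ord i)|exact: uG (ltn_ord k)| |].
  by move=> e; case/eqP: ik; apply: ord_inj; apply: uinj e; apply/mem_set/ltn_ord.
have [chiB _ _] := cyl j.
by apply: positive_cylinder_meet (cyl i) (cyl k) chiB _ _; apply: hc.
Qed.
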